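(* For every prime power $q$, $$A_q(12, 6; 6) \ge q^{24}+q^{15}+q^{14}+2q^{13}+3q^{12}+3q^{11}+3q^{10}+3q^9+q^8-q^7-2q^6-3q^5-3q^4-q^3-2q^2-q-1 .$$
   Context: For a prime power $q$, the subspace distance between subspaces $U,U'$ of $\mathbb{F}_q^n$ is $d(U,U')=\dim(U+U')-\dim(U\cap U')$. $A_q(n,d;k)$ denotes the maximum cardinality of a set of $k$-dimensional subspaces of $\mathbb{F}_q^n$ any two distinct elements of which have subspace distance at least $d$ (a set with at most one element satisfies this vacuously). *)

(* Defs.v *)
From HB Require Import structures.
From mathcomp Require Import all_boot all_order all_algebra all_field.

Set Implicit Arguments.
Unset Strict Implicit.
Unset Printing Implicit Defensive.

(* The subtype structure of {vspace vT} lives in this module. *)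
Import VectorInternalTheory.

(* Over a finite field, a {vspace vT} is a subtype of a finite matrix type,
   hence a finType. *)
HB.instance Definition _ (F : finFieldType) (vT : vectType F) :=
  [Countable of {vspace vT} by <:].
HB.instance Definition _ (F : finFieldType) (vT : vectType F) :=
  [Finite of {vspace vT} by <:].

(* The subtraction of naturals is exact, since U :&: V is included in U + V. *)
Definition subspace_dist (F : fieldType) (vT : vectType F)
    (U V : {vspace vT}) : nat :=
  \dim (U + V) - \dim (U :&: V).

Definition is_subspace_code (F : finFieldType) (n d k : nat)
    (C : {set {vspace 'rV[F]_n}}) : bool :=
  [forall U in C, \dim U == k] &&
  [forall U in C, forall V in C, (U != V) ==> (d <= subspace_dist U V)].

(* A_q(n,d;k), with q = #|F|; the value depends on F only through its
   cardinality, as finite fields of the same order are isomorphic. *)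
Definition max_subspace_code (F : finFieldType) (n d k : nat) : nat :=
  \max_(C : {set {vspace 'rV[F]_n}} | is_subspace_code d k C) #|C|.

Definition prime_power (q : nat) : Prop :=
  exists p m : nat, [/\ prime p, 0 < m & q = p ^ m].

(* Main.v *)
Require Import Defs.
From mathcomp Require Import all_boot all_order all_algebra all_field.
From HB Require Import structures.
From mathcomp Require Import zify ring.
Import Order.TTheory GRing.Theory Num.Theory.
Local Open Scope ring_scope.

Set Implicit Arguments.
Unset Strict Implicit.
Unset Printing Implicit Defensive.

(** For two 6-dimensional subspaces the subspace distance is at least 6 exactly
when they meet in dimension at most 3.  The code is a union of three families
of 6-subspaces of V + V, where V has dimension 6 over the field of q elements.
Let E1 and E2 be the two summands, and let C be a linear space of 6 x 6
matrices of dimension 24 whose nonzero elements have kernel of dimension at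
most 3 (a Gabidulin code; [exists_mrd]).

- The q^24 graphs of the elements of C.  Two graphs meet in a copy of the
  kernel of the difference, and all of them are disjoint from E2.
- The transposed graphs of the elements of C whose kernel has dimension exactly
  3.  They are disjoint from E1 and meet E2 in dimension 3.  For each
  3-subspace K of V the elements of C that vanish on K form a space of dimension
  at least 24 - 18 = 6, and the nonzero ones have kernel K; this gives at
  least N (q^6 - 1) members, where N is the number of 3-subspaces of V
  ([card_mxker_dim], [card_subspaces]).
- Sums of a 3-subspace A of E1 and a 3-subspace B of E2, which meet both E1 and
  E2 in dimension 3.  Write V = X + X, and take spaces C1 <= C2 of 3 x 3
  matrices of dimensions 3 and 6 whose nonzero elements have kernels of
  dimension 0 and at most 1, respectively.  The pairs (A, B) are
  (graph M, graph N) with M, N in C2 congruent modulo C1, and (graph M, S) and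
  (S, graph M) with M in C1, where S is the second summand of X + X; this gives
  q^9 + 2 q^3 members ([exists_product_code]).

Members of different families meet in dimension at most 3, since inside a
6-space X the intersections with E and with Y are independent as soon as Y is
disjoint from E ([dimv_cap_disjoint]).  The sum of the three sizes is the
claimed bound. *)

(** * Extensions of finite fields *)

Lemma exprDn_cardX (F : finFieldType) (L : fieldExtType F) i (x y : L) :
  (x + y) ^+ (#|F| ^ i) = x ^+ (#|F| ^ i) + y ^+ (#|F| ^ i).
Proof.
have [p p_pr pcharF] := finPcharP F.
have pcharL : p \in [pchar L] by rewrite pchar_lalg.
apply: exprDn_pchar.
rewrite pnatX (card_pprimeChar pcharF) (eq_pnat _ (pcharf_eq pcharL)).
by rewrite pnatX pnat_id.
Qed.

Lemma exprZn_cardX (F : finFieldType) (L : fieldExtType F) i c (x : L) :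
  (c *: x) ^+ (#|F| ^ i) = c *: x ^+ (#|F| ^ i).
Proof.
rewrite exprZn; congr (_ *: _).
by elim: i => [|i IHi]; rewrite ?expr1 // expnS exprM expf_card.
Qed.

(** A finite field F has an extension of each positive degree n: in a splitting
field of 'X^Q - 'X, with Q = #|F| ^ n, the Q distinct roots are the elements
fixed by the n-th power of the Frobenius automorphism. *)
Lemma finField_extension (F : finFieldType) (n : nat) :
  (0 < n)%N -> exists L : fieldExtType F, \dim {:L} = n.
Proof.
move=> n_gt0; pose Q := (#|F| ^ n)%N.
have Q_gt1 : (1 < Q)%N by rewrite -(expn0 #|F|) ltn_exp2l ?finNzRing_gt1.
pose P := 'X^Q - 'X : {poly F}.
have sizeP : size P = Q.+1.
  by rewrite size_polyDl size_polyXn // size_polyN size_polyX.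
have /FinSplittingFieldFor[/= L [zs Pzs _]] : P != 0.
  by rewrite -size_poly_gt0 sizeP.
have Uzs : uniq zs.
  rewrite -separable_prod_XsubC -(eqp_separable Pzs).
  rewrite [map_poly _ _]rmorphB rmorphXn /= map_polyX separable_poly.unlock.
  rewrite derivB derivXn derivX.
  (* The derivative of 'X^Q - 'X is - 1. *)
  suff -> : 'X^(Q.-1) *+ Q = 0 :> {poly L}.
    rewrite sub0r -[- 1]scaleN1r coprimepZr ?oppr_eq0 ?oner_eq0 //.
    exact: coprimep1.
  have [p p_pr pcharF] := finPcharP F.
  have pcharL : p \in [pchar L] by rewrite pchar_lalg.
  rewrite -mulr_natr; apply/eqP; rewrite mulf_eq0; apply/orP; right.
  rewrite -polyC_natr polyC_eq0 -(dvdn_pcharf pcharL).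
  rewrite /Q (card_pprimeChar pcharF) -expnM.
  rewrite dvdn_exp // muln_gt0 n_gt0 andbT.
  rewrite -(ltn_exp2l _ _ (prime_gt1 p_pr)) -(card_pprimeChar pcharF).
  exact: finNzRing_gt1.
have [a _ Da] := finField_galois_generator (sub1v {:L}).
pose E : {subfield L} := fixedField [set (a ^+ n)%g].
have aX z i : (a ^+ i)%g z = z ^+ (#|F| ^ i).
  elim: i => [|i IHi]; first by rewrite gal_id expr1.
  by rewrite expgSr galM ?memvf // IHi Da ?memvf // dimv1 expn1 -exprM expnSr.
have inE z : (z \in E) = (z \in zs).
  rewrite -root_prod_XsubC -(eqp_root Pzs).
  rewrite [map_poly _ _]rmorphB rmorphXn /= map_polyX.
  rewrite rootE !hornerE subr_eq0 -aX.
  apply/fixedFieldP/eqP; rewrite ?memvf //; first by apply; rewrite set11.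
  by move=> az x /set1P->.
exists (subvs_of E); rewrite dimvf -[dim _]/(\dim E).
have cardE : #|(E : {vspace (finvect_type L)})| = Q.
  have size_zs : size zs = Q.
    apply: succn_inj.
    by rewrite -(size_prod_XsubC zs id) -(eqp_size Pzs) size_map_poly.
  rewrite -size_zs -(@card_uniqP (finvect_type L) zs Uzs).
  by apply: eq_card => z; exact: inE.
have := @card_vspace F (finvect_type L) _ E.
by rewrite cardE => /(expnI (finNzRing_gt1 F)).
Qed.

(** * Maximum rank distance codes *)

(** The kernel of the map u |-> u *m M on row vectors. *)
Definition mxker (F : fieldType) m n (M : 'M[F]_(m, n)) : {vspace 'rV[F]_m} :=
  lker (linfun (mulmxr M)).

Lemma memv_mxker (F : fieldType) m n (M : 'M[F]_(m, n)) u :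
  (u \in mxker M) = (u *m M == 0).
Proof. by rewrite memv_ker lfunE. Qed.

Section Gabidulin.
Import VectorInternalTheory.
Variables (F : finFieldType) (L : fieldExtType F).

(** The value at x of the linearized polynomial with coefficients a, that is
a_0 'X + a_1 'X^q + ... + a_(k-1) 'X^(q^(k-1)). *)
Definition qpoly_eval (k : nat) (a : {ffun 'I_k -> L}) (x : L) : L :=
  \sum_(i < k) a i * x ^+ (#|F| ^ i).

Lemma qpoly_eval_is_linear k (a : {ffun 'I_k -> L}) : linear (qpoly_eval a).
Proof.
move=> c x y; rewrite /qpoly_eval scaler_sumr -big_split; apply: eq_bigr => i _.
by rewrite exprDn_cardX exprZn_cardX mulrDr scalerAr.
Qed.

Lemma qpoly_eval_linear_coef k c (a b : {ffun 'I_k -> L}) x :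
  qpoly_eval (c *: a + b) x = c *: qpoly_eval a x + qpoly_eval b x.
Proof.
rewrite /qpoly_eval scaler_sumr -big_split; apply: eq_bigr => i _.
by rewrite !ffunE mulrDl scalerAl.
Qed.

Lemma card_qpoly_roots k (a : {ffun 'I_k -> L}) (s : seq L) : a != 0 ->
  uniq s -> {in s, forall x, qpoly_eval a x = 0} -> (size s <= #|F| ^ k.-1)%N.
Proof.
move=> nz_a Us s0.
have q_gt1 := finNzRing_gt1 F.
pose p : {poly L} := \sum_(i < k) a i *: 'X^(#|F| ^ i).
have pE i : p`_(#|F| ^ nat_of_ord i) = a i.
  rewrite coef_sum (bigD1 i) //= coefZ coefXn eqxx mulr1.
  rewrite big1 ?addr0 // => j ne_ji.
  by rewrite coefZ coefXn eqn_exp2l // val_eqE eq_sym (negPf ne_ji) mulr0.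
have nz_p : p != 0.
  apply: contraNneq nz_a => p0; apply/eqP/ffunP => i.
  by rewrite ffunE -pE p0 coef0.
have hp : {in s, forall x, root p x}.
  move=> x /s0 x0; rewrite rootE horner_sum -[X in _ == X]x0; apply/eqP.
  by apply: eq_bigr => i _; rewrite hornerZ hornerXn.
have lt_s_p := max_poly_roots nz_p (introT allP hp) Us.
rewrite -ltnS; apply: leq_trans lt_s_p _.
apply: (leq_trans (size_sum _ _ _)); apply/bigmax_leqP => i _.
apply: (leq_trans (size_scale_leq _ _)); rewrite size_polyXn ltnS.
by rewrite leq_exp2l // -ltnS (ltn_predK (ltn_ord i)).
Qed.

(** The linearized polynomial, as a map on coordinate vectors over F. *)
Let qpoly_row k a : 'rV[F]_(dim L) -> 'rV[F]_(dim L) :=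
  v2r \o @qpoly_eval k a \o r2v.

Fact qpoly_row_is_linear k a : linear (@qpoly_row k a).
Proof.
by move=> c x y; rewrite /qpoly_row /= linearP qpoly_eval_is_linear linearP.
Qed.

HB.instance Definition _ k a :=
  GRing.isLinear.Build F 'rV[F]_(dim L) 'rV[F]_(dim L) _ (qpoly_row a)
    (@qpoly_row_is_linear k a).

(** The matrix over F of a linearized polynomial. *)
Definition qpoly_mx k (a : {ffun 'I_k -> L}) : 'M[F]_(dim L) :=
  lin1_mx (qpoly_row a).

Lemma mul_qpoly_mx k (a : {ffun 'I_k -> L}) u :
  u *m qpoly_mx a = v2r (qpoly_eval a (r2v u)).
Proof. exact: mul_rV_lin1. Qed.

Fact qpoly_mx_is_linear k : linear (@qpoly_mx k).
Proof.
move=> c a b; apply/row_matrixP => i.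
by rewrite linearP /= !rowE !mul_qpoly_mx qpoly_eval_linear_coef linearP.
Qed.

HB.instance Definition _ k :=
  GRing.isLinear.Build F {ffun 'I_k -> L} 'M[F]_(dim L) _ (@qpoly_mx k)
    (@qpoly_mx_is_linear k).

(** The Gabidulin code: the matrices of the linearized polynomials with k
coefficients. *)
Definition gabidulin k : {vspace 'M[F]_(dim L)} := limg (linfun (@qpoly_mx k)).

Lemma dim_mxker_qpoly_mx k (a : {ffun 'I_k -> L}) : a != 0 ->
  (\dim (mxker (qpoly_mx a)) < k)%N.
Proof.
move=> nz_a.
have k_gt0 : (0 < k)%N.
  case: k a nz_a => // a; case/eqP; apply/ffunP; by case.
suff : (\dim (mxker (qpoly_mx a)) <= k.-1)%N.
  by rewrite -ltnS (prednK k_gt0).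
rewrite -(leq_exp2l _ _ (finNzRing_gt1 F)).
rewrite -card_vspace cardE -(size_map r2v).
apply: (card_qpoly_roots nz_a).
  by rewrite map_inj_uniq ?enum_uniq //; apply: r2v_inj.
move=> _ /mapP[u + ->]; rewrite mem_enum memv_mxker mul_qpoly_mx => /eqP u0.
by apply: v2r_inj; rewrite u0 linear0.
Qed.

Lemma mem_gabidulin k (a : {ffun 'I_k -> L}) : qpoly_mx a \in gabidulin k.
Proof. by rewrite -[qpoly_mx a](lfunE (@qpoly_mx k)) memv_img ?memvf. Qed.

Lemma dim_gabidulin k : (k <= dim L)%N -> \dim (gabidulin k) = (k * dim L)%N.
Proof.
move=> le_k_n; rewrite limg_dim_eq.
  by rewrite dimvf -[dim _]/(#|'I_k| * dim L)%N card_ord.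
rewrite capfv; apply/eqP; rewrite -subv0; apply/subvP => a.
rewrite memv_ker lfunE /= memv0 => /eqP a0; apply: contraTT le_k_n => nz_a.
have := dim_mxker_qpoly_mx nz_a; rewrite a0 -ltnNge.
have -> : mxker (0 : 'M[F]_(dim L)) = fullv.
  by apply/vspaceP => u; rewrite memv_mxker mulmx0 eqxx memvf.
by rewrite dimvf [dim _]mul1n.
Qed.

Lemma gabidulinS k : (gabidulin k <= gabidulin k.+1)%VS.
Proof.
apply/subvP => _ /memv_imgP[a _ ->]; rewrite lfunE /=.
pose b : {ffun 'I_k.+1 -> L} :=
  [ffun i => if unlift ord_max i is Some j then a j else 0].
suff -> : qpoly_mx a = qpoly_mx b by apply: mem_gabidulin.
apply/row_matrixP => i; rewrite !rowE !mul_qpoly_mx; congr v2r.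
rewrite /qpoly_eval big_ord_recr /= ffunE unlift_none mul0r addr0.
apply: eq_bigr => j _.
have -> : widen_ord (leqnSn k) j = lift ord_max j.
  by apply: val_inj; rewrite /= /bump leqNgt ltn_ord.
by rewrite ffunE liftK.
Qed.
End Gabidulin.

(** Nested linear maximum rank distance codes: for k <= n, the nonzero elements
of the code of dimension k * n have kernel of dimension less than k, that is,
rank greater than n - k. *)
Theorem exists_mrd (F : finFieldType) (n : nat) : (0 < n)%N ->
  exists C : nat -> {vspace 'M[F]_n},
    [/\ forall k, (C k <= C k.+1)%VS,
        forall k, (k <= n)%N -> \dim (C k) = (k * n)%N
      & forall k M, M \in C k -> M != 0 -> (\dim (mxker M) < k)%N].
Proof.
move=> /(finField_extension F)[L]; rewrite dimvf => <-.
exists (gabidulin L); split=> [||k _ /memv_imgP[a _ ->]].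
- exact: gabidulinS.
- exact: dim_gabidulin.
rewrite lfunE /= => nz_a; apply: dim_mxker_qpoly_mx.
by apply: contraNneq nz_a => ->; rewrite linear0.
Qed.

(** * Counting subspaces, and matrices with a kernel of given dimension *)

Lemma dimv_rV (F : fieldType) n : \dim {:'rV[F]_n} = n.
Proof. by rewrite dimvf [dim _]mul1n. Qed.

Section Count.
Variables (F : finFieldType) (n : nat).
Local Notation q := #|F|.
Local Notation V := 'rV[F]_n.
Implicit Types U K : {vspace V}.

(** Extending a free k-tuple t of U amounts to choosing a vector of U outside
the span of t. *)
Lemma card_free_tuples k U :
  #|[set t : k.-tuple V | free t & (<<t>> <= U)%VS]|
    = (\prod_(i < k) (q ^ \dim U - q ^ i))%N.
Proof.
elim: k => [|k IHk].
  rewrite big_ord0 -[RHS](cards1 (nil_tuple V)); apply: eq_card => t.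
  by rewrite !inE [t]tuple0 span_nil nil_free sub0v eqxx.
idtac.
pose cns (p : k.-tuple V * V) := cons_tuple p.2 p.1.
have cns_bij : bijective cns.
  exists (fun t => (behead_tuple t, thead t)) => [[t v]|t].
    by congr pair; apply: val_inj.
  by rewrite [RHS]tuple_eta.
rewrite -sum1_card big_ord_recr /= -IHk (reindex cns) /=; last exact: onW_bij.
transitivity (\sum_(t : k.-tuple V | free t && (<<t>> <= U)%VS)
                \sum_(v | (v \notin <<t>>%VS) && (v \in U)) 1)%N.
  rewrite pair_big_dep; apply: eq_bigl => -[t v].
  by rewrite inE /= free_cons span_cons subv_add -memvE andbACA andbC.
rewrite -sum1_card big_distrl /=; apply: eq_big => t; first by rewrite inE.
case/andP=> /eqP dimt tU; rewrite size_tuple in dimt.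
rewrite mul1n sum1_card -[X in (_ - _ ^ X)%N]dimt -!card_vspace.
rewrite -[#|U|]cardsE -[#|<<t>>%VS|]cardsE.
have /setIidPr <- : [set v in <<t>>%VS] \subset [set v in U].
  by apply/subsetP => v; rewrite !inE; apply: (subvP tU).
by rewrite -cardsD; apply: eq_card => v; rewrite !inE.
Qed.

(** The number of k-subspaces, as a quotient of the number of free k-tuples of
the whole space by the number of those with a given span. *)
Lemma card_subspaces k :
  (#|[set K : {vspace V} | \dim K == k]| * \prod_(i < k) (q ^ k - q ^ i)
    = \prod_(i < k) (q ^ n - q ^ i))%N.
Proof.
have := card_free_tuples k {:V}; rewrite dimv_rV => <-.
rewrite -[RHS]sum1_card (partition_big (fun t : k.-tuple V => <<t>>%VS)
  (fun K => \dim K == k)) /=; last first.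
  by move=> t; rewrite inE => /andP[/eqP-> _]; rewrite size_tuple.
rewrite mulnC -[X in (_ * X)%N]sum1_card big_distrr /=.
apply: eq_big => K; first by rewrite inE.
rewrite inE muln1 => /eqP dimK.
have := card_free_tuples k K; rewrite dimK => <-; rewrite -sum1_card.
apply: eq_bigl => t; rewrite !inE subvf andbT; apply: andb_id2l => /eqP dimt.
by rewrite eqEdim dimt size_tuple dimK leqnn andbT.
Qed.

(** Vanishing on the k-subspace K imposes k * n linear conditions on C, so at
least n dimensions remain, and the nonzero solutions have kernel exactly K. *)
Lemma card_mxker_eq k (C : {vspace 'M[F]_n}) K :
  \dim C = (k.+1 * n)%N ->
  (forall M, M \in C -> M != 0 -> (\dim (mxker M) <= k)%N) ->
  \dim K = k -> (q ^ n - 1 <= #|[set M in C | mxker M == K]|)%N.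
Proof.
move=> dimC kerC dimK.
pose B := \matrix_(i < \dim K) (vbasis K)`_i.
pose A := (C :&: lker (linfun (mulmx B)))%VS.
have dimA : (n <= \dim A)%N.
  have := limg_ker_dim (linfun (mulmx B)) C; rewrite dimC mulSn => dimA.
  have : (\dim (linfun (mulmx B) @: C) <= k * n)%N.
    rewrite -dimK -[X in (_ <= X)%N]/(dim 'M[F]_(\dim K, n)) -dimvf.
    by rewrite dimvS ?subvf.
  by rewrite -(leq_add2l (\dim A)) dimA leq_add2r.
have lb : (q ^ n - 1 <= #|[set M in A] :\ 0%R|)%N.
  have := cardsD1 (0 : 'M[F]_n) [set M in A].
  rewrite inE mem0v cardsE card_vspace => E.
  by rewrite leq_subLR -E leq_exp2l ?finNzRing_gt1.
apply: leq_trans lb (subset_leq_card _); apply/subsetP => M.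
rewrite !inE memv_cap memv_ker lfunE /= => /and3P[nzM MC /eqP BM0].
rewrite MC /= eq_sym eqEdim dimK kerC // andbT.
rewrite -{1}(span_basis (vbasisP K)); apply/span_subvP => v /tnthP[i ->].
rewrite memv_mxker (tnth_nth 0) -[_`_i](rowK (fun i => (vbasis K)`_i)) -/B.
by rewrite -row_mul BM0 row0.
Qed.

Lemma card_mxker_dim k (C : {vspace 'M[F]_n}) :
  \dim C = (k.+1 * n)%N ->
  (forall M, M \in C -> M != 0 -> (\dim (mxker M) <= k)%N) ->
  (#|[set K : {vspace V} | \dim K == k]| * (q ^ n - 1)
    <= #|[set M in C | \dim (mxker M) == k]|)%N.
Proof.
move=> dimC kerC; rewrite -[X in (_ <= X)%N]sum1_card.
rewrite (partition_big (fun M : 'M[F]_n => mxker M)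
  (fun K => \dim K == k)) /=; last first.
  by move=> M; rewrite inE => /andP[].
rewrite mulnC -[X in (_ * X)%N]sum1_card big_distrr /=.
rewrite (eq_bigl (fun K : {vspace V} => \dim K == k)); last first.
  by move=> K; rewrite inE.
apply: leq_sum => K /eqP dimK; rewrite muln1.
apply: leq_trans (card_mxker_eq dimC kerC dimK) _.
rewrite -sum1_card; apply/eq_leq/eq_bigl => M; rewrite !inE -andbA.
apply: andb_id2l => _.
by case: eqP => [->|]; rewrite ?andbF // dimK eqxx.
Qed.
End Count.

(** * Graphs and direct sums *)

(** f is only required to be injective on U. *)
Lemma dimv_le_inj (F : fieldType) (vT wT : vectType F) (f : {linear vT -> wT})
    (U : {vspace vT}) (W : {vspace wT}) :
  {in U, forall u, f u \in W} -> {in U, forall u, f u = 0 -> u = 0} ->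
  (\dim U <= \dim W)%N.
Proof.
move=> fUW finj; rewrite -(@limg_dim_eq _ _ _ (linfun f)).
  by apply: dimvS; apply/subvP => _ /memv_imgP[u Uu ->]; rewrite lfunE fUW.
apply/eqP; rewrite -subv0; apply/subvP => u.
by rewrite memv_cap memv_ker lfunE memv0 => /andP[Uu /eqP /finj->].
Qed.

Lemma dimv_cap_disjoint (F : fieldType) (vT : vectType F)
    (E X Y : {vspace vT}) :
  (Y :&: E = 0)%VS -> (\dim (X :&: Y) + \dim (X :&: E) <= \dim X)%N.
Proof.
move=> YE0; rewrite -dimv_disjoint_sum.
  by apply: dimvS; rewrite subv_add !capvSl.
apply/eqP; rewrite -subv0 -YE0 subv_cap.
rewrite (subv_trans (capvSl _ _) (capvSr _ _)).
by rewrite (subv_trans (capvSr _ _) (capvSr _ _)).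
Qed.

Section Geometry.
Variables (F : fieldType) (n : nat).
Local Notation V := 'rV[F]_n.
Local Notation W := 'rV[F]_(n + n).
Implicit Types (A B : {vspace V}) (M N : 'M[F]_n).

(** The direct sum of A, in the first summand, and B, in the second one. *)
Definition prodv A B : {vspace W} :=
  (linfun (@lsubmx F 1 n n) @^-1: A :&: linfun (@rsubmx F 1 n n) @^-1: B)%VS.

Lemma memv_prodv A B u :
  (u \in prodv A B) = (lsubmx u \in A) && (rsubmx u \in B).
Proof. by rewrite memv_cap -!memv_preim !lfunE. Qed.

Lemma prodv_cap A B A' B' :
  (prodv A B :&: prodv A' B' = prodv (A :&: A') (B :&: B'))%VS.
Proof. by apply/vspaceP => u; rewrite !(memv_cap, memv_prodv) andbACA. Qed.

Lemma dim_prodv A B : \dim (prodv A B) = (\dim A + \dim B)%N.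
Proof.
rewrite -(limg_ker_dim (linfun (@lsubmx F 1 n n)) (prodv A B)) addnC.
congr (_ + _)%N.
  congr (\dim _); apply/vspaceP => x; apply/memv_imgP/idP => [[u]|Ax].
    by rewrite memv_prodv => /andP[uA _] ->; rewrite lfunE.
  exists (row_mx x 0); rewrite ?lfunE /= ?row_mxKl //.
  by rewrite memv_prodv row_mxKl row_mxKr Ax mem0v.
rewrite -(@limg_dim_eq _ _ _ (linfun (@rsubmx F 1 n n))).
  congr (\dim _); apply/vspaceP => x; apply/memv_imgP/idP => [[u]|Bx].
    by rewrite memv_cap memv_prodv => /andP[/andP[_ uB] _] ->; rewrite lfunE.
  exists (row_mx 0 x); rewrite ?lfunE /= ?row_mxKr //.
  rewrite memv_cap memv_prodv memv_ker lfunE /= row_mxKl row_mxKr Bx mem0v.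
  exact: eqxx.
apply/eqP; rewrite -subv0; apply/subvP => u.
rewrite !(memv_cap, memv_ker) !lfunE memv0 /=.
case/andP=> /andP[_ /eqP l0] /eqP r0.
by rewrite -(hsubmxK u) l0 r0 row_mx0.
Qed.

(** The subspaces {(x, x M)} and {(x M, x)}. *)
Definition graphv M : {vspace W} := mxker (col_mx M (- 1%:M)).
Definition cographv M : {vspace W} := mxker (col_mx (- 1%:M) M).

Lemma memv_graphv M u : (u \in graphv M) = (rsubmx u == lsubmx u *m M).
Proof.
by rewrite memv_mxker -{1}(hsubmxK u) mul_row_col mulmxN mulmx1 subr_eq0 eq_sym.
Qed.

Lemma memv_cographv M u : (u \in cographv M) = (lsubmx u == rsubmx u *m M).
Proof.
rewrite memv_mxker -{1}(hsubmxK u) mul_row_col mulmxN mulmx1.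
by rewrite addrC subr_eq0 eq_sym.
Qed.

Lemma graphv_disjoint M : (graphv M :&: prodv 0 fullv = 0)%VS.
Proof.
apply/eqP; rewrite -subv0; apply/subvP => u.
rewrite memv_cap memv_graphv memv_prodv !memv0.
case/andP=> /eqP ru /andP[/eqP lu _].
by rewrite -(hsubmxK u) ru lu mul0mx row_mx0.
Qed.

Lemma cographv_disjoint M : (cographv M :&: prodv fullv 0 = 0)%VS.
Proof.
apply/eqP; rewrite -subv0; apply/subvP => u.
rewrite memv_cap memv_cographv memv_prodv !memv0.
case/andP=> /eqP lu /andP[_ /eqP ru].
by rewrite -(hsubmxK u) lu ru mul0mx row_mx0.
Qed.

Lemma dim_graphv M : \dim (graphv M) = n.
Proof.
apply/eqP; rewrite -[X in _ == X](dimv_rV F) eqn_leq; apply/andP; split.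
  apply: (@dimv_le_inj _ _ _ (@lsubmx F 1 n n)) => u; first by rewrite memvf.
  rewrite memv_graphv => /eqP ru lu.
  by rewrite -(hsubmxK u) ru lu mul0mx row_mx0.
apply: (@dimv_le_inj _ _ _ (mulmxr (row_mx 1%:M M))) => u _ /=.
  by rewrite memv_graphv mul_mx_row row_mxKl row_mxKr mulmx1.
rewrite mul_mx_row mulmx1 => /(congr1 (@lsubmx F 1 n n)).
by rewrite row_mxKl linear0.
Qed.

Lemma dim_cographv M : \dim (cographv M) = n.
Proof.
apply/eqP; rewrite -[X in _ == X](dimv_rV F) eqn_leq; apply/andP; split.
  apply: (@dimv_le_inj _ _ _ (@rsubmx F 1 n n)) => u; first by rewrite memvf.
  rewrite memv_cographv => /eqP lu ru.
  by rewrite -(hsubmxK u) lu ru mul0mx row_mx0.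
apply: (@dimv_le_inj _ _ _ (mulmxr (row_mx M 1%:M))) => u _ /=.
  by rewrite memv_cographv mul_mx_row row_mxKl row_mxKr mulmx1.
rewrite mul_mx_row mulmx1 => /(congr1 (@rsubmx F 1 n n)).
by rewrite row_mxKr linear0.
Qed.

Lemma dim_graphv_cap M N :
  (\dim (graphv M :&: graphv N) <= \dim (mxker (M - N)))%N.
Proof.
apply: (@dimv_le_inj _ _ _ (@lsubmx F 1 n n)) => u;
  rewrite memv_cap !memv_graphv.
  by move=> /andP[/eqP-> ]; rewrite memv_mxker mulmxBr subr_eq0.
by move=> /andP[/eqP ru _] lu; rewrite -(hsubmxK u) ru lu mul0mx row_mx0.
Qed.

Lemma dim_cographv_cap M N :
  (\dim (cographv M :&: cographv N) <= \dim (mxker (M - N)))%N.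
Proof.
apply: (@dimv_le_inj _ _ _ (@rsubmx F 1 n n)) => u;
  rewrite memv_cap !memv_cographv.
  by move=> /andP[/eqP-> ]; rewrite memv_mxker mulmxBr subr_eq0.
by move=> /andP[/eqP lu _] ru; rewrite -(hsubmxK u) lu ru mul0mx row_mx0.
Qed.

Lemma dim_cographv_capr M :
  (\dim (mxker M) <= \dim (cographv M :&: prodv 0 fullv))%N.
Proof.
apply: (@dimv_le_inj _ _ _ (mulmxr (row_mx 0 1%:M))) => u /=.
  rewrite memv_mxker memv_cap memv_cographv memv_prodv mul_mx_row mulmx0 mulmx1.
  by rewrite row_mxKl row_mxKr mem0v memvf !andbT eq_sym.
move=> _; rewrite mul_mx_row mulmx1 => /(congr1 (@rsubmx F 1 n n)).
by rewrite row_mxKr linear0.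
Qed.
End Geometry.

(** * Codes with bounded intersections *)

Section Code.
Variables (F : finFieldType) (vT : vectType F) (k t : nat).
Hypothesis lt_tk : (t < k)%N.
Implicit Types C D : {set {vspace vT}}.

(** The elements of C have dimension k, and any two distinct ones meet in
dimension at most t; this is minimum subspace distance at least 2 (k - t). *)
Definition cap_code C : Prop :=
  {in C, forall U, \dim U = k} /\
  {in C &, forall U V, U != V -> (\dim (U :&: V) <= t)%N}.

(** As t < k, the bound on intersections makes w injective on D. *)
Lemma cap_code_imset (I : finType) (D : {set I}) (w : I -> {vspace vT}) :
  {in D, forall i, \dim (w i) = k} ->
  {in D &, forall i j, i != j -> (\dim (w i :&: w j) <= t)%N} ->
  cap_code (w @: D) /\ #|w @: D| = #|D|.
Proof.
move=> dimw capw; split; last first.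
  apply: card_in_imset => i j Di Dj eq_w; apply/eqP.
  apply: contraTT lt_tk => ne_ij.
  by rewrite -leqNgt -(dimw i Di) -{1}(capvv (w i)) {2}eq_w capw.
split=> [_ /imsetP[i Di ->]|_ _ /imsetP[i Di ->] /imsetP[j Dj ->] ne_w].
  exact: dimw.
by apply: capw => //; apply: contraNneq ne_w => ->.
Qed.

Lemma cap_code_setU C D : cap_code C -> cap_code D ->
  {in C & D, forall U V, (\dim (U :&: V) <= t)%N} ->
  cap_code (C :|: D) /\ #|C :|: D| = (#|C| + #|D|)%N.
Proof.
move=> [dimC capC] [dimD capD] capCD; split; last first.
  rewrite cardsU [C :&: D](_ : _ = set0) ?cards0 ?subn0 //.
  apply/setP => U; rewrite !inE; apply/andP => -[CU DU].
  by have := capCD U U CU DU; rewrite capvv dimC // leqNgt lt_tk.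
split=> [U|U V]; first by case/setUP; [apply: dimC | apply: dimD].
case/setUP=> [CU|DU] /setUP[CV|DV] ne_UV;
  [exact: capC | exact: capCD | | exact: capD].
by rewrite capvC capCD.
Qed.
End Code.

Lemma cap_code_subspace_code (F : finFieldType) n k t
    (C : {set {vspace 'rV[F]_n}}) :
  cap_code k t C -> is_subspace_code ((k - t) * 2) k C.
Proof.
move=> [dimC capC]; apply/andP; split.
  by apply/forall_inP => U CU; rewrite dimC.
apply/forall_inP => U CU; apply/forall_inP => V CV; apply/implyP => ne_UV.
have := capC U V CU CV ne_UV; have := dimv_sum_cap U V; rewrite /subspace_dist.
rewrite (dimC U) // (dimC V) //; lia.
Qed.

(** * The construction *)

Section Product.
Variables (F : finFieldType) (m k : nat).
Local Notation q := #|F|.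
Hypotheses (m_gt0 : (0 < m)%N) (lt_km : (k < m)%N) (le_k2m : (k.*2 <= m)%N).
Local Notation E1 := (@prodv F (m + m) fullv 0).
Local Notation E2 := (@prodv F (m + m) 0 fullv).
Local Notation S := (@prodv F m 0 fullv).

(** The sums of an m-subspace of E1 and an m-subspace of E2.  With D i the
code of dimension i * m of [exists_mrd], the q ^ (k.+2 * m) pairs of graphs are
those of M and M + d for M in D k.+1 and d in D 1; the other pairs combine S
with the graph of an element of D 1.  If both graphs of a pair differ from those
of another one, they meet in dimension at most k each, whence 2 k <= m. *)
Lemma exists_product_code :
  exists C : {set {vspace 'rV[F]_((m + m) + (m + m))}},
  [/\ cap_code (m + m) m C,
      {in C, forall U, \dim (U :&: E1) = m /\ \dim (U :&: E2) = m}
    & #|C| = (q ^ (k.+2 * m) + q ^ m * 2)%N].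
Proof.
have [D [Dmono dimD kerD]] := exists_mrd F m_gt0.
have lt_m2m : (m < m + m)%N by lia.
have D1k M : M \in D 1 -> M \in D k.+1.
  apply/subvP; elim: k => [|i IHi]; first exact: subvv.
  exact: subv_trans IHi (Dmono _).
have cap1 M N : M - N \in D 1 -> M != N -> \dim (graphv M :&: graphv N) = 0%N.
  move=> D1 ne_MN; apply/eqP.
  rewrite -leqn0 (leq_trans (dim_graphv_cap M N)) //.
  by rewrite -ltnS kerD // subr_eq0.
have capk M N : M - N \in D k.+1 -> M != N ->
    (\dim (graphv M :&: graphv N) <= k)%N.
  move=> Dk ne_MN; rewrite (leq_trans (dim_graphv_cap M N)) //.
  by rewrite -ltnS kerD // subr_eq0.
have dimS : \dim S = m by rewrite dim_prodv dimv0 dimv_rV.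
have capS M : \dim (graphv M :&: S) = 0%N by rewrite graphv_disjoint dimv0.
have dimE A B : \dim A = m -> \dim B = m ->
    \dim (prodv A B :&: E1) = m /\ \dim (prodv A B :&: E2) = m.
  move=> dA dB; rewrite !prodv_cap !dim_prodv !capvf !capv0 !dimv0.
  by rewrite dA dB addn0.
have le_cap A B A' B' a b :
    (\dim (A :&: A') <= a)%N -> (\dim (B :&: B') <= b)%N ->
    (a + b <= m)%N ->
    (\dim (prodv A B :&: prodv A' B' : {vspace 'rV[F]_(m + m + (m + m))})
      <= m)%N.
  by move=> ca cb ab; rewrite prodv_cap dim_prodv; lia.
pose w1 (p : 'M[F]_m * 'M[F]_m) := prodv (graphv p.1) (graphv (p.1 + p.2)).
pose w2 (M : 'M[F]_m) := prodv (graphv M) S.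
pose w3 (M : 'M[F]_m) := prodv S (graphv M).
pose I1 := setX [set M in D k.+1] [set M in D 1].
pose I2 := [set M in D 1].
have cardI2 : #|I2| = (q ^ m)%N.
  by rewrite cardsE card_vspace dimD // mul1n.
have cardI1 : #|I1| = (q ^ (k.+2 * m))%N.
  rewrite cardsX cardI2 cardsE card_vspace dimD // -expnD; congr (_ ^ _)%N; lia.
have [code1 card1] : cap_code (m + m) m (w1 @: I1) /\ #|w1 @: I1| = #|I1|.
  apply: cap_code_imset => // [p _|[M d] [M' d']].
    by rewrite dim_prodv !dim_graphv.
  rewrite !inE /= => /andP[DM Dd] /andP[DM' Dd'] ne_p; rewrite /w1 /=.
  have [eqM|neM] := eqVneq M M'.
    apply: (le_cap _ _ _ _ m 0%N); rewrite ?addn0 //.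
      by rewrite eqM capvv dim_graphv.
    rewrite eqM cap1 //; first by rewrite opprD addrACA subrr add0r memvB.
    by apply: contraNneq ne_p => /addrI->; rewrite eqM.
  have [eqN|neN] := eqVneq (M + d) (M' + d').
    apply: (le_cap _ _ _ _ 0%N m); rewrite ?add0n //; last first.
      by rewrite eqN capvv dim_graphv.
    rewrite cap1 // (_ : M - M' = d' - d) ?memvB //.
    by apply: (addIr d); rewrite subrK addrAC eqN addrC addKr.
  apply: (le_cap _ _ _ _ k k); rewrite ?addnn //; apply: capk => //.
    exact: memvB.
  by rewrite memvB // memvD // D1k.
have [code2 card2] : cap_code (m + m) m (w2 @: I2) /\ #|w2 @: I2| = #|I2|.
  apply: cap_code_imset => // [M _|M M'].
    by rewrite dim_prodv dimS dim_graphv.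
  rewrite !inE => DM DM' neM.
  apply: (le_cap _ _ _ _ 0%N m); rewrite ?add0n // ?capvv ?dimS //.
  by rewrite cap1 // memvB.
have [code3 card3] : cap_code (m + m) m (w3 @: I2) /\ #|w3 @: I2| = #|I2|.
  apply: cap_code_imset => // [M _|M M'].
    by rewrite dim_prodv dimS dim_graphv.
  rewrite !inE => DM DM' neM.
  apply: (le_cap _ _ _ _ m 0%N); rewrite ?addn0 // ?capvv ?dimS //.
  by rewrite cap1 // memvB.
have [code12 card12] : cap_code (m + m) m (w1 @: I1 :|: w2 @: I2)
    /\ #|w1 @: I1 :|: w2 @: I2| = (#|w1 @: I1| + #|w2 @: I2|)%N.
  apply: cap_code_setU => // _ _ /imsetP[[M d] + ->] /imsetP[M' + ->].
  rewrite !inE /= => /andP[DM Dd] DM'; rewrite /w1 /w2 /=.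
  apply: (le_cap _ _ _ _ m 0%N); rewrite ?addn0 // ?capS //.
  by rewrite -[X in (_ <= X)%N](dim_graphv M) dimvS ?capvSl.
have [codeC cardC] : cap_code (m + m) m (w1 @: I1 :|: w2 @: I2 :|: w3 @: I2)
    /\ #|w1 @: I1 :|: w2 @: I2 :|: w3 @: I2|
      = (#|w1 @: I1 :|: w2 @: I2| + #|w3 @: I2|)%N.
  apply: cap_code_setU => // _ _ /setUP[]/imsetP[p Ip ->] /imsetP[M IM ->].
    apply: (le_cap _ _ _ _ 0%N m); rewrite ?add0n // ?capS //.
    by rewrite -[X in (_ <= X)%N](dim_graphv M) dimvS ?capvSr.
  by apply: (le_cap _ _ _ _ 0%N 0%N); rewrite ?capS // capvC capS.
exists (w1 @: I1 :|: w2 @: I2 :|: w3 @: I2); split=> //.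
  move=> _ /setUP[/setUP[]|] /imsetP[p _ ->]; apply: dimE;
    by rewrite ?dim_graphv.
by rewrite cardC card12 card1 card2 card3 cardI1 cardI2 muln2 -addnn addnA.
Qed.
End Product.

(** The union of the three families for general m, with ambient space of
dimension 4 m and distance 2 m. *)
Theorem exists_combined_code (F : finFieldType) (m k : nat) :
  (0 < m)%N -> (k < m)%N -> (k.*2 <= m)%N ->
  exists C : {set {vspace 'rV[F]_((m + m) + (m + m))}}, cap_code (m + m) m C /\
    (#|F| ^ (m.+1 * (m + m))
      + #|[set K : {vspace 'rV[F]_(m + m)} | \dim K == m]|
        * (#|F| ^ (m + m) - 1)
      + (#|F| ^ (k.+2 * m) + #|F| ^ m * 2) <= #|C|)%N.
Proof.
move=> m_gt0 lt_km le_k2m.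
have [T [codeT capT cardT]] := exists_product_code F m_gt0 lt_km le_k2m.
have [|D [_ dimD kerD]] := @exists_mrd F (m + m).
  by rewrite addn_gt0 m_gt0.
have lt_m2m : (m < m + m)%N by lia.
have {}dimD : \dim (D m.+1) = (m.+1 * (m + m))%N by apply: dimD; lia.
have {}kerD M : M \in D m.+1 -> M != 0 -> (\dim (mxker M) <= m)%N.
  exact: kerD.
pose P := [set M in D m.+1 | \dim (mxker M) == m].
pose L := [set M in D m.+1].
have [codeP cardP] : cap_code (m + m) m (@cographv _ _ @: P)
    /\ #|@cographv _ _ @: P| = #|P|.
  apply: cap_code_imset => // [M _|M N]; first exact: dim_cographv.
  rewrite !inE => /andP[DM _] /andP[DN _] ne_MN.
  by rewrite (leq_trans (dim_cographv_cap M N)) // kerD ?memvB ?subr_eq0.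
have [codeL cardL] : cap_code (m + m) m (@graphv _ _ @: L)
    /\ #|@graphv _ _ @: L| = #|L|.
  apply: cap_code_imset => // [M _|M N]; first exact: dim_graphv.
  rewrite !inE => DM DN ne_MN.
  by rewrite (leq_trans (dim_graphv_cap M N)) // kerD ?memvB ?subr_eq0.
have cap_le (X Y E : {vspace 'rV[F]_((m + m) + (m + m))}) :
    (Y :&: E = 0)%VS -> \dim X = (m + m)%N ->
    (m <= \dim (X :&: E))%N -> (\dim (X :&: Y) <= m)%N.
  by move=> YE0 dimX leXE; have := dimv_cap_disjoint X YE0; lia.
have [codeTP cardTP] : cap_code (m + m) m (T :|: @cographv _ _ @: P)
    /\ #|T :|: @cographv _ _ @: P| = (#|T| + #|@cographv _ _ @: P|)%N.
  apply: cap_code_setU => // X _ TX /imsetP[M _ ->].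
  apply: cap_le (cographv_disjoint M) (proj1 codeT X TX) _.
  by rewrite (proj1 (capT X TX)).
have [codeC cardC] :
    cap_code (m + m) m (T :|: @cographv _ _ @: P :|: @graphv _ _ @: L)
    /\ #|T :|: @cographv _ _ @: P :|: @graphv _ _ @: L|
      = (#|T :|: @cographv _ _ @: P| + #|@graphv _ _ @: L|)%N.
  apply: cap_code_setU => // X _ TPX /imsetP[M _ ->].
  apply: cap_le (graphv_disjoint M) (proj1 codeTP X TPX) _.
  case/setUP: TPX => [TX|/imsetP[N + ->]]; first by rewrite (proj2 (capT X TX)).
  by rewrite inE => /andP[_ /eqP {1}<-]; apply: dim_cographv_capr.
exists (T :|: @cographv _ _ @: P :|: @graphv _ _ @: L); split=> //.
have cardL0 : #|L| = (#|F| ^ (m.+1 * (m + m)))%N.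
  by rewrite cardsE card_vspace dimD.
have := card_mxker_dim dimD kerD.
rewrite cardC cardTP cardT cardP cardL cardL0 -/P => le_P.
rewrite [leqRHS]addnC [X in (_ <= _ + X)%N]addnC [leqRHS]addnA.
by rewrite leq_add2r leq_add2l.
Qed.

Theorem mainTheorem3 (q : nat) (hq : prime_power q)
    (F : finFieldType) (hF : #|F| = q) :
  (max_subspace_code F 12 6 6)%:Z >=
    q%:Z ^+ 24 + q%:Z ^+ 15 + q%:Z ^+ 14 + 2 * q%:Z ^+ 13 + 3 * q%:Z ^+ 12
    + 3 * q%:Z ^+ 11 + 3 * q%:Z ^+ 10 + 3 * q%:Z ^+ 9 + q%:Z ^+ 8 - q%:Z ^+ 7
    - 2 * q%:Z ^+ 6 - 3 * q%:Z ^+ 5 - 3 * q%:Z ^+ 4 - q%:Z ^+ 3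
    - 2 * q%:Z ^+ 2 - q%:Z - 1.
Proof.
have q_gt1 : (1 < q)%N by rewrite -hF finNzRing_gt1.
have [C [codeC leC]] := @exists_combined_code F 3 1 isT isT isT.
have le_max : (#|C| <= max_subspace_code F 12 6 6)%N.
  apply: (@leq_bigmax_cond _
    (fun C : {set {vspace 'rV[F]_12}} => is_subspace_code 6 6 C)
    (fun C => #|C|)).
  exact: cap_code_subspace_code codeC.
have := card_subspaces F 6%N 3%N; rewrite !big_ord_recr !big_ord0 /= !mul1n hF.
move: leC; rewrite hF -[(3 + 3)%N]/6%N.
set N := #|_| => leC; rewrite -/N => cardN.
have PoszX a : (q ^ a)%N%:Z = q%:Z ^+ a.
  by elim: a => // a IHa; rewrite expnS PoszM IHa exprS.
have Nz : N%:Z * ((q%:Z ^+ 3 - 1) * (q%:Z ^+ 3 - q%:Z)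
      * (q%:Z ^+ 3 - q%:Z ^+ 2))
    = (q%:Z ^+ 6 - 1) * (q%:Z ^+ 6 - q%:Z) * (q%:Z ^+ 6 - q%:Z ^+ 2).
  have subz a b : (b <= a)%N -> (q ^ a - q ^ b)%N%:Z = q%:Z ^+ a - q%:Z ^+ b.
    by move=> le_ba; rewrite -subzn ?leq_pexp2l ?(ltnW q_gt1) // !PoszX.
  have := congr1 Posz cardN.
  by rewrite !PoszM !subz // expr0 expr1.
have qz_gt1 : 1 < q%:Z by lia.
(* The value of N is the Gaussian binomial coefficient 6 choose 3. *)
have NE : N%:Z = (q%:Z ^+ 3 + 1) * (q%:Z ^+ 2 + 1)
    * (q%:Z ^+ 4 + q%:Z ^+ 3 + q%:Z ^+ 2 + q%:Z + 1).
  have nz : (q%:Z ^+ 3 - 1) * (q%:Z ^+ 3 - q%:Z)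
      * (q%:Z ^+ 3 - q%:Z ^+ 2) != 0.
    rewrite !mulf_neq0 // subr_eq0 gt_eqF //.
    - by rewrite exprn_egt1.
    - by rewrite -[X in X < _]expr1 ltr_eXn2l.
    - by rewrite ltr_eXn2l.
  by apply: (mulIf nz); rewrite Nz; ring.
have := leq_trans leC le_max; rewrite -lez_nat; apply: le_trans.
rewrite !PoszD !PoszM NE -subzn ?expn_gt0 ?(ltnW q_gt1) // !PoszX.
rewrite le_eqVlt; apply/orP; left; apply/eqP; ring.
Qed.
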